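(* For each $j$ let $P_j(z,\zeta)$ be a Borel function on $\left(\bigcup_{m=1}^{j-1}K_m\right)\times K_j$, and let $P(z,\zeta)$ be a function on $\left(\bigcup_{m\ge1}K_m\right)\times K_0$. Assume that for each $m$ and each $z\in K_m$ the functions $P_j(z,\cdot)$, $j>m$, are uniformly bounded (in $j$ and $\zeta$) and the sequence $\{P_j(z,\cdot)\}_{j>m}$ has strong limit values $P(z,\cdot)$ with respect to $M$. Let $p>1$ and $\phi\in\mathcal A^p(M)$ with weak limit values $\phi_*$, and suppose $$\phi_m(z)\le\int_{K_j}P_j(z,\zeta)\phi_j(\zeta)\,d\mu_j(\zeta)$$ for all $j$, all $m<j$ and all $z\in K_m$. Then for every $m$ and every $z\in K_m$, $$\phi_m(z)\le\int_{K_0}P(z,\zeta)\phi_*(\zeta)\,d\mu(\zeta).$$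
   Context: $K$ is a compact metric space and $M=\{\mu_j\}_{j\ge1}$ is a sequence of finite positive regular Borel measures on $K$ converging weak-* in $C(K)^*$ (i.e. $\int h\,d\mu_j\to\int h\,d\mu$ for all $h\in C(K)$) to a finite positive Borel measure $\mu$; $K_j=\operatorname{supp}\mu_j$, $K_0=\operatorname{supp}\mu$. A ''sequence'' $\phi=\{\phi_j\}$ means a sequence of real Borel functions $\phi_j$ on $K_j$ (a sequence indexed by $j>m$ is treated the same way); $\|\phi\|_{L^p(M)}=\limsup_j\|\phi_j\|_{L^p(K_j,\mu_j)}$. $\phi$ has weak limit values $\phi_*$ if $\phi_*$ is $\mu$-integrable on $K_0$ and $\int_{K_j}h\phi_j\,d\mu_j\to\int_{K_0}h\phi_*\,d\mu$ for all $h\in C(K)$; $\mathcal A^p(M)$ is the set of sequences with weak limit values and $\|\phi\|_{L^p(M)}<\infty$. A sequence $\phi$ has strong limit values $\phi^*$ (a real $\mu$-measurable function on $K_0$) if for all real $a<b$ and all $\varepsilon,\delta>0$ there are $j_0$ and an open set $O\subset K$ containing $\{x\in K_0:a\le\phi^*(x)<b\}$ such that $\mu_j(\{x\in K_j:\phi_j(x)<a-\varepsilon\}\cap O)+\mu_j(\{x\in K_j:\phi_j(x)>b+\varepsilon\}\cap O)<\delta$ for all $j\ge j_0$. *)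

(* Defs.v *)
From HB Require Import structures.
From mathcomp Require Import all_boot all_order all_algebra.
From mathcomp Require Import all_classical all_reals all_analysis.
Set Implicit Arguments. Unset Strict Implicit. Unset Printing Implicit Defensive.
Import Order.TTheory GRing.Theory Num.Theory.
Import numFieldNormedType.Exports.
Local Open Scope classical_set_scope.
Local Open Scope ring_scope.


Section defs.
Context {R : realType} {T : ptopologicalType}.
Local Notation B := (g_sigma_algebraType (@open T)).

Definition msupp (mu : set B -> \bar R) : set B :=
  [set x | forall U : set B, @open T U -> U x -> (0 < mu U)%E].

(* f is mu-measurable on D: it agrees mu-a.e. on D with a Borel function
   (i.e. it is measurable for the completion of mu). *)
Definition mu_measurable (mu : {measure set B -> \bar R}) (D : set B)
    (f : B -> R) : Prop :=
  exists g : B -> R, measurable_fun D g /\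
    {ae mu, forall x, D x -> f x = g x}.

Definition mu_integrable (mu : {measure set B -> \bar R}) (D : set B)
    (f : B -> R) : Prop :=
  mu_measurable mu D f /\ (\int[mu]_(x in D) (`|f x|)%:E < +oo)%E.

Definition Lp_norm (mu : {measure set B -> \bar R}) (p : R) (f : B -> R)
    : \bar R :=
  ((\int[mu]_(x in msupp mu) (`|f x| `^ p)%:E) `^ p^-1)%E.

Definition weak_star_cvg (mu : nat -> {measure set B -> \bar R})
    (mu0 : {measure set B -> \bar R}) : Prop :=
  forall h : T -> R, continuous h ->
    (fun j => (\int[mu j]_x (h x)%:E)%E) @ \oo --> (\int[mu0]_x (h x)%:E)%E.

Definition is_sequence (mu : nat -> {measure set B -> \bar R})
    (phi : nat -> B -> R) : Prop :=
  forall j, measurable_fun (msupp (mu j)) (phi j).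

Definition LpM_norm (mu : nat -> {measure set B -> \bar R}) (p : R)
    (phi : nat -> B -> R) : \bar R :=
  limn_esup (fun j => Lp_norm (mu j) p (phi j)).

Definition weak_limit_values (mu : nat -> {measure set B -> \bar R})
    (mu0 : {measure set B -> \bar R}) (phi : nat -> B -> R)
    (phistar : B -> R) : Prop :=
  mu_integrable mu0 (msupp mu0) phistar /\
  forall h : T -> R, continuous h ->
    (fun j => (\int[mu j]_(x in msupp (mu j)) (h x * phi j x)%:E)%E) @ \oo -->
      (\int[mu0]_(x in msupp mu0) (h x * phistar x)%:E)%E.

Definition in_Ap (mu : nat -> {measure set B -> \bar R})
    (mu0 : {measure set B -> \bar R}) (p : R) (phi : nat -> B -> R)
    (phistar : B -> R) : Prop :=
  is_sequence mu phi /\ weak_limit_values mu mu0 phi phistar /\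
  (LpM_norm mu p phi < +oo)%E.

(* phi has strong limit values phistar.  (Since j0 is existential, it does
   not matter whether the sequence is indexed by all j or by j > m.) *)
Definition strong_limit_values (mu : nat -> {measure set B -> \bar R})
    (mu0 : {measure set B -> \bar R}) (phi : nat -> B -> R)
    (phistar : B -> R) : Prop :=
  mu_measurable mu0 (msupp mu0) phistar /\
  forall a b : R, a < b -> forall eps delta : R, 0 < eps -> 0 < delta ->
    exists j0 : nat, exists O : set B, @open T O /\
      [set x | msupp mu0 x /\ a <= phistar x < b] `<=` O /\
      forall j, (j0 <= j)%N ->
        (mu j ([set x | msupp (mu j) x /\ (phi j x < a - eps)%R] `&` O) +
         mu j ([set x | msupp (mu j) x /\ (phi j x > b + eps)%R] `&` O)
           < delta%:E)%E.

End defs.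

(* Main.v *)
(* Fix z in K_m and put q_j = P_j(z, .).  By the strong limit hypothesis applied
   to half-open slabs [a, b) outside [-C, C], the limit q_0 = P(z, .) agrees
   mu-a.e. with a Borel function g bounded by the common bound C of the q_j.
   Given s > 0, inner and outer regularity of mu yield a continuous h with
   |h| <= C and |g - h| <= s off a set of mu-measure < s.  Covering [-C, C] by
   finitely many slabs, the open sets of the strong limit hypothesis and the
   portmanteau inequality for closed sets give mu_j(|q_j - h| > 4s) < s for
   large j.  Since the phi_j are bounded in L^p with p > 1, they are uniformly
   integrable, so replacing q_j by h in the integral of q_j phi_j costs little.
   Finally the integral of h phi_j tends to that of h phi_*, which is close to
   that of g phi_*. *)
Require Import Defs.
From HB Require Import structures.
From mathcomp Require Import all_boot all_order all_algebra.
From mathcomp Require Import finmap.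
From mathcomp Require Import all_classical all_reals all_analysis.
From mathcomp Require Import measurable_realfun ring lra.
Import Order.TTheory GRing.Theory Num.Theory.
Import numFieldNormedType.Exports.
Local Open Scope classical_set_scope.
Local Open Scope ring_scope.

(** * Inner and outer regularity of finite Borel measures *)

Section regularity.
Set Implicit Arguments.
Unset Strict Implicit.
Unset Printing Implicit Defensive.
Context {R : realType} {T : pseudoPMetricType R}.
Local Notation B := (g_sigma_algebraType (@open T)).

Lemma open_borel (U : set T) : open U -> measurable (U : set B).
Proof. by move=> oU; exact: sub_sigma_algebra. Qed.

Lemma closed_borel (U : set T) : closed U -> measurable (U : set B).
Proof.
move=> cU; rewrite -(setCK U); apply: measurableC.
by apply: open_borel; exact: closed_openC.
Qed.

(** The open sets are the neighbourhoods of [F] of radius [1/(n+1)]. Interiors of balls are taken so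
    that openness is immediate; a point in all of them is at distance zero from [F]. *)
Lemma closed_bigcap_open (F : set T) : closed F ->
  exists G : nat -> set T, [/\ forall n, open (G n),
    nonincreasing_seq G & \bigcap_n G n = F].
Proof.
move=> cF; exists (fun n => \bigcup_(x in F) (ball x n.+1%:R^-1)°); split.
- by move=> n; apply: bigcup_open => x _; exact: open_interior.
- move=> m n mn; apply/subsetPset => y [x Fx xy]; exists x => //.
  move: xy; apply: interiorS; apply: le_ball.
  by rewrite lef_pV2 ?posrE// ler_nat.
- apply/seteqP; split => [y Gy|x Fx n _]; last first.
    by exists x => //; apply: nbhsx_ballx; rewrite invr_gt0.
  apply: cF => A /nbhs_ballP[e /= e0 eA].
  have [n ne] : exists n : nat, n.+1%:R^-1 < e.
    have := near_infty_natSinv_lt (PosNum e0).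
    by move=> [N _ /(_ N)]/= h; exists N; exact: h.
  have [x Fx /interior_subset xy] := Gy n I.
  exists x; split => //; apply: eA.
  exact/(le_ball (ltW ne))/ball_sym.
Qed.

(** Good sets principle: the sets that can be approximated in this way form a sigma-algebra
    containing the closed sets, hence all Borel sets. *)
Lemma borel_regular (mu : {finite_measure set B -> \bar R}) (A : set B) :
  measurable A -> forall e : R, 0 < e ->
  exists F G : set T, [/\ closed F, open G, F `<=` A, A `<=` G
    & (mu (G `\` F) < e%:E)%E].
Proof.
pose C := [set A : set B | forall e : R, 0 < e ->
  exists F G : set T, [/\ closed F, open G, F `<=` A, A `<=` G
    & (mu (G `\` F) < e%:E)%E]].
have Cclosed (F : set T) : closed F -> C F.
  move=> cF e e0; have [G [oG dG GF]] := closed_bigcap_open cF.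
  have mF : measurable (F : set B) by exact: closed_borel.
  have mG n : measurable (G n : set B) by exact: open_borel.
  (* Continuity from above, [mu] being finite: the sets [G n] minus [F] decrease to the empty
     set. *)
  have : mu \o (fun n => G n `\` F) @ \oo --> mu (\bigcap_n (G n `\` F)).
    apply: nonincreasing_cvg_mu.
    - by rewrite ltey_eq fin_num_measure//; exact: measurableD.
    - by move=> n; exact: measurableD.
    - by apply: bigcap_measurable => // n _; exact: measurableD.
    - move=> m n mn; apply/subsetPset; apply: setSD.
      by have /subsetPset := dG _ _ mn.
  have -> : \bigcap_n (G n `\` F) = set0.
    rewrite -subset0 => x Gx; have [_] := Gx 0%N I; apply.
    by rewrite -GF => n _; have [] := Gx n I.
  rewrite measure0 => /fine_cvgP[fi /cvgrPdist_lt/(_ _ e0)].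
  move=> [N _ /(_ N (leqnn _))] /=; rewrite sub0r normrN.
  move=> h; exists F, (G N); split => //.
    by rewrite -GF; exact: bigcap_inf.
  rewrite -[X in (X < _)%E]fineK; last first.
    by rewrite fin_num_measure//; exact: measurableD.
  by rewrite lte_fin; exact: le_lt_trans (ler_norm _) h.
have sC : sigma_algebra setT C.
  split.
  - exact: Cclosed closed0.
  (* Complementation exchanges the inner and the outer set and leaves their difference unchanged. *)
  - move=> D CD e e0; have [F [G [cF oG FD DG h]]] := CD _ e0.
    exists (~` G), (~` F); split.
    + exact: open_closedC.
    + exact: closed_openC.
    + by move=> x Gx; split => // Dx; apply: Gx; exact: DG.
    + by move=> x [_ Dx] Fx; apply: Dx; exact: FD.
    + by rewrite setDE setCK setIC -setDE.
  - move=> D CD e e0.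
    have e20 : 0 < e / 2 by rewrite divr_gt0.
    have /choice[FG hFG] : forall i, exists FG : set T * set T,
        [/\ closed FG.1, open FG.2, FG.1 `<=` D i, D i `<=` FG.2
          & (mu (FG.2 `\` FG.1) < (e / 2 / (2 ^ i.+1)%:R)%:E)%E].
      move=> i; have [|F [G h]] := CD i (e / 2 / (2 ^ i.+1)%:R).
        by rewrite divr_gt0// ltr0n expn_gt0.
      by exists (F, G).
    pose G := \bigcup_i (FG i).2.
    (* An infinite union of closed sets need not be closed, so the inner set is a finite union. One
       half of [e] pays for the gaps of the single pairs, the other half for stopping at a finite
       [n]. *)
    pose F n := \big[setU/set0]_(i < n) (FG i).1.
    have oG : open G by apply: bigcup_open => i _; have [] := hFG i.
    have cF n : closed (F n).
      by rewrite /F; apply: closed_bigsetU => i _; have [] := hFG i.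
    have FE n : F n = \bigcup_(i in `I_n) (FG i).1.
      by rewrite /F (bigcup_mkord n (fun i => (FG i).1)).
    have mF n : measurable (F n : set B) by exact: closed_borel.
    have mG : measurable (G : set B) by exact: open_borel.
    have : mu \o (fun n => G `\` F n) @ \oo --> mu (\bigcap_n (G `\` F n)).
      apply: nonincreasing_cvg_mu.
      - by rewrite ltey_eq fin_num_measure//; exact: measurableD.
      - by move=> n; exact: measurableD.
      - by apply: bigcap_measurable => // n _; exact: measurableD.
      - move=> m n mn; apply/subsetPset; apply: setDS.
        rewrite !FE => x [i /= im Fx]; exists i => //=.
        exact: leq_trans im mn.
    have mFG i : measurable ((FG i).2 `\` (FG i).1 : set B).
      have [? ? _ _ _] := hFG i.
      by apply: measurableD; [exact: open_borel|exact: closed_borel].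
    have lim_le : (mu (\bigcap_n (G `\` F n)) <= (e / 2)%:E)%E.
      apply: (@le_trans _ _ (\sum_(i <oo) mu ((FG i).2 `\` (FG i).1))%E).
        apply: measure_sigma_subadditive => //.
          by apply: bigcap_measurable => // n _; exact: measurableD.
        move=> x Gx; have [[i _ Gix] _] := Gx 0%N I.
        exists i => //; split => // Fix.
        (* [F n] collects the indices below [n], so [F i.+1] is the first to contain the [i]-th
           closed set. *)
        have [_] := Gx i.+1 I; apply; rewrite !FE.
        by exists i => /=.
      apply: le_trans (epsilon_trick0 xpredT (ltW e20)).
      apply: lee_nneseries => //= i _; have [_ _ _ _ h] := hFG i.
      exact: ltW.
    move=> cv; have fl : mu (\bigcap_n (G `\` F n)) \is a fin_num.
      apply: fin_num_measure; apply: bigcap_measurable => // n _.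
      exact: measurableD.
    move: cv; rewrite -(fineK fl) => /fine_cvgP[_ /cvgrPdist_lt/(_ _ e20)].
    move=> [N _ /(_ N (leqnn _))] /= h.
    exists (F N), G; split => //.
    + rewrite !FE => x [i _ Fx]; exists i => //.
      by have [_ _ FD _ _] := hFG i; exact: FD.
    + move=> x [i _ Dx]; exists i => //.
      by have [_ _ _ DG _] := hFG i; exact: DG.
    + have fN : mu (G `\` F N) \is a fin_num.
        by rewrite fin_num_measure//; exact: measurableD.
      rewrite -(fineK fN) lte_fin.
      have : fine (mu (\bigcap_n (G `\` F n))) <= e / 2.
        by rewrite -lee_fin fineK.
      move: h; rewrite ltr_distlC; lra.
suff : <<s @open T >> `<=` C by apply.
apply: smallest_sub => // U oU.
have [_ CC _] := sC; rewrite -(setCK U) -setTD; apply: CC.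
by apply: Cclosed; exact: open_closedC.
Qed.

End regularity.

(** * Supports, bump functions and the portmanteau inequalities *)

Section weak_star.
Set Implicit Arguments.
Unset Strict Implicit.
Unset Printing Implicit Defensive.
Context {R : realType} {T : pseudoPMetricType R}.
Local Notation B := (g_sigma_algebraType (@open T)).

Lemma continuous_borel (h : T -> R) :
  continuous h -> measurable_fun setT (h : B -> R).
Proof.
move=> /continuousP ch; apply: (measurability _ (RGenOpens.measurableE R)).
move=> _ [_ [a [b ->] <-]]; rewrite setTI; apply: open_borel.
exact/ch/interval_open.
Qed.

Lemma msupp_closed (mu : set B -> \bar R) : @closed T (msupp mu).
Proof.
rewrite -[X in closed X]setCK; apply: open_closedC.
rewrite openE => x /existsNP[U /not_implyP[oU /not_implyP[Ux U0]]].
rewrite /interior nbhsE; exists U; first by split.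
by move=> y Uy /(_ U oU Uy).
Qed.

Lemma msupp_measurable (mu : set B -> \bar R) : measurable (msupp mu : set B).
Proof. by apply: closed_borel; exact: msupp_closed. Qed.

Hypothesis hK : compact [set: T].

(** By inner regularity it is enough to treat a closed subset of the complement of the support. It
    is compact and covered by open null sets, so finitely many of them cover it. *)
Lemma msupp_full (mu : {finite_measure set B -> \bar R}) :
  mu (~` msupp mu) = 0%E.
Proof.
have mS : measurable (~` msupp mu) by apply: measurableC; exact: msupp_measurable.
apply/eqP; rewrite eq_le measure_ge0 andbT; apply/lee_addgt0Pr => e e0.
rewrite add0e; have [F [G [cF oG FS SG h]]] := borel_regular mu mS e0.
have mF : measurable (F : set B) by exact: closed_borel.
have mG : measurable (G : set B) by exact: open_borel.
suff F0 : mu F = 0%E.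
  apply: le_trans (ltW h); apply: (@le_trans _ _ (mu G)).
    by apply: le_measure; rewrite ?inE.
  rewrite (measureDI mu mG mF) (_ : G `&` F = F); last first.
    by apply/setIidPr; exact: subset_trans SG.
  by rewrite [X in (_ + X)%E]F0 adde0.
have cptF : compact F by exact: (subclosed_compact cF hK).
have : cover_compact F by rewrite -compact_cover.
move=> /(_ (set T) [set U : set T | open U /\ mu (U : set B) = 0%E] id) [||D DU FD].
- by move=> U [].
- move=> x /FS/existsNP[U /not_implyP[oU /not_implyP[Ux /negP]]].
  by rewrite lt0e measure_ge0 andbT negbK => /eqP U0; exists U.
have {}DU U : U \in D -> open U /\ mu (U : set B) = 0%E.
  by move=> /DU; rewrite inE.
pose N : set B := \big[setU/set0]_(U <- D | U \in D) (U : set B).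
have [mN N0] : measurable N /\ mu N = 0%E.
  apply: (big_ind (fun U : set B => measurable U /\ mu U = 0%E)) => //.
  - by move=> U V [mU U0] [mV V0]; split; [exact: measurableU|rewrite measureU0].
  - by move=> U /DU[oU ->]; split => //; exact: open_borel.
have FN : F `<=` N by rewrite /N -big_seq -bigcup_fset.
exact: subset_measure0 mF mN FN N0.
Qed.

Hypothesis hT : hausdorff_space T.

Lemma urysohn_bump (F G : set T) : closed F -> open G -> F `<=` G ->
  exists u : T -> R, [/\ continuous u, forall x, 0 <= u x <= 1,
    forall x, F x -> u x = 1 & forall x, ~ G x -> u x = 0].
Proof.
move=> cF oG FG.
have cG : closed (~` G) by exact: open_closedC.
have GF0 : ~` G `&` F = set0.
  by rewrite -subset0 => x [Gx /FG].
have [u [cu u0 u1 u01]] :=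
  urysohn_ext_itv (compact_normal hT hK) cG cF GF0 (@ltr01 R).
exists u; split => //.
- by move=> x; have := u01 _ (imageT u x); rewrite /= in_itv.
- by move=> x Fx; apply: u1; exists x.
- by move=> x Gx; apply: u0; exists x.
Qed.

Lemma bump_integral_le (mu : {measure set B -> \bar R}) (G : set T)
    (u : T -> R) : continuous u -> open G -> (forall x, 0 <= u x <= 1) ->
  (forall x, ~ G x -> u x = 0) -> (\int[mu]_x (u x)%:E <= mu G)%E.
Proof.
move=> cu oG u01 u0.
have mG : measurable (G : set B) by exact: open_borel.
have -> : mu G = (\int[mu]_x (\1_(G : set B) x)%:E)%E.
  by rewrite integral_indic// setIT.
apply: ge0_le_integral => //.
- by move=> x _; rewrite lee_fin; have /andP[] := u01 x.
- by apply/measurable_EFinP; exact: continuous_borel.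
- by apply/measurable_EFinP; exact: measurable_indic.
move=> x _; rewrite lee_fin indicE.
have [|/negP Gx] := boolP (x \in (G : set B)).
  by have /andP[] := u01 x.
by rewrite u0 ?lexx// => Gx'; apply: Gx; rewrite inE.
Qed.

Lemma bump_integral_ge (mu : {measure set B -> \bar R}) (F : set T)
    (u : T -> R) : continuous u -> closed F -> (forall x, 0 <= u x <= 1) ->
  (forall x, F x -> u x = 1) -> (mu F <= \int[mu]_x (u x)%:E)%E.
Proof.
move=> cu cF u01 u1.
have mF : measurable (F : set B) by exact: closed_borel.
have -> : mu F = (\int[mu]_x (\1_(F : set B) x)%:E)%E.
  by rewrite integral_indic// setIT.
apply: ge0_le_integral => //.
- by apply/measurable_EFinP; exact: measurable_indic.
- by apply/measurable_EFinP; exact: continuous_borel.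
move=> x _; rewrite lee_fin indicE.
have [|_] := boolP (x \in (F : set B)); last by have /andP[] := u01 x.
by rewrite inE => /u1 ->.
Qed.

Variables (mu : nat -> {finite_measure set B -> \bar R}).
Variable mu0 : {finite_measure set B -> \bar R}.
Hypothesis hmu : weak_star_cvg mu mu0.

(** Outer regularity gives an open [G] around [F] with [mu0 G] still below [c]. A bump function
    between [F] and [G] is then an admissible test function for the weak-* convergence. *)
Lemma weak_star_closed (F : set T) (c : R) : closed F -> (mu0 F < c%:E)%E ->
  \forall j \near \oo, (mu j F < c%:E)%E.
Proof.
move=> cF Fc.
have mF : measurable (F : set B) by exact: closed_borel.
have fF : mu0 F \is a fin_num by rewrite fin_num_measure.
have e0 : 0 < c - fine (mu0 F) by rewrite subr_gt0 -lte_fin fineK.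
have [F' [G [cF' oG F'F FG h]]] := borel_regular mu0 mF e0.
have mG : measurable (G : set B) by exact: open_borel.
have mF' : measurable (F' : set B) by exact: closed_borel.
have Gc : (mu0 G < c%:E)%E.
  rewrite (measureDI mu0 mG mF) (_ : G `&` F = F); last exact/setIidPr.
  rewrite -[c](subrK (fine (mu0 F))) EFinD fineK// lteD2rE//.
  apply: le_lt_trans h; apply: le_measure; rewrite ?inE//; try exact: measurableD.
  exact: setDS.
have [u [cu u01 u1 u0]] := urysohn_bump cF oG FG.
have /(_ _ cu) cv := hmu.
have uc : (\int[mu0]_x (u x)%:E < c%:E)%E.
  exact: le_lt_trans (bump_integral_le mu0 cu oG u01 u0) Gc.
have : \forall j \near \oo, (\int[mu j]_x (u x)%:E < c%:E)%E.
  exact: (cv _ (open_ereal_lt' uc)).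
apply: filterS => j; apply: le_lt_trans.
exact: bump_integral_ge.
Qed.

(** Dual argument: exhaust [G] from inside by a closed [F] and test with a bump function that is 1
    on [F] and vanishes off [G]. *)
Lemma weak_star_open (G : set T) (d : R) : open G ->
  (\forall j \near \oo, (mu j G <= d%:E)%E) -> (mu0 G <= d%:E)%E.
Proof.
move=> oG Gd.
have mG : measurable (G : set B) by exact: open_borel.
apply/lee_addgt0Pr => e e0.
have [F [G' [cF oG' FG GG' h]]] := borel_regular mu0 mG e0.
have mG' : measurable (G' : set B) by exact: open_borel.
have mF : measurable (F : set B) by exact: closed_borel.
have [u [cu u01 u1 u0]] := urysohn_bump cF oG FG.
have /(_ _ cu) cv := hmu.
have Fd : (mu0 F <= d%:E)%E.
  apply: le_trans (bump_integral_ge _ cu cF u01 u1) _.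
  rewrite -(cvg_lim _ cv)//; apply: lime_le; first by apply/cvg_ex; eexists; exact: cv.
  apply: filterS Gd => j; apply: le_trans; exact: bump_integral_le.
rewrite (measureDI mu0 mG mF) (_ : G `&` F = F); last exact/setIidPr.
rewrite addeC leeD//; apply: le_trans (ltW h).
by apply: le_measure; rewrite ?inE//; [exact: measurableD..|exact: setSD].
Qed.

End weak_star.

(** * Approximation of bounded Borel functions by continuous ones off a small set *)

Section approximation.
Set Implicit Arguments.
Unset Strict Implicit.
Unset Printing Implicit Defensive.
Context {R : realType} {T : pseudoPMetricType R}.
Local Notation B := (g_sigma_algebraType (@open T)).

(** For [C >= 0] this is the truncation of [t] to the interval [[-C, C]]; written with absolute
    values, it is visibly continuous. *)
Definition clamp (C t : R) : R := (`|t + C| - `|t - C|) / 2.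

Lemma continuous_clamp (C : R) : continuous (clamp C).
Proof.
move=> t; apply: cvgMl; apply: cvgB; apply: cvg_norm.
- by apply: cvgD; [exact: cvg_id|exact: cvg_cst].
- by apply: cvgB; [exact: cvg_id|exact: cvg_cst].
Qed.

Lemma clamp_le (C t : R) : 0 <= C -> `|clamp C t| <= C.
Proof.
rewrite /clamp => C0; rewrite ler_norml.
by case: (ger0P (t + C)); case: (ger0P (t - C)) => *; apply/andP; split; lra.
Qed.

Lemma clamp_id (C t : R) : `|t| <= C -> clamp C t = t.
Proof.
rewrite /clamp ler_norml => /andP[tC Ct].
rewrite ger0_norm ?ler0_norm; lra.
Qed.

Lemma clamp_lip (C s t : R) : 0 <= C -> `|clamp C s - clamp C t| <= `|s - t|.
Proof.
move=> C0; have mono (x y : R) : x <= y -> 0 <= clamp C y - clamp C x <= y - x.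
  rewrite /clamp => xy.
  case: (ger0P (x + C)); case: (ger0P (x - C));
  case: (ger0P (y + C)); case: (ger0P (y - C)) => *; apply/andP; split; lra.
have [/mono/andP[a0 a1]|/ltW/mono/andP[a0 a1]] := lerP s t.
  by rewrite (distrC (clamp C s)) ger0_norm//.
by rewrite ger0_norm//.
Qed.

Hypothesis hK : compact [set: T].
Hypothesis hT : hausdorff_space T.

(* Halving the range: peel off the upper half-level set of g, whose indicator
   is approximated by a bump function between a closed and an open set. *)
Lemma dyadic_approx (mu : {finite_measure set B -> \bar R}) (n : nat)
    (g : B -> R) (L d : R) : 0 < L -> 0 < d -> measurable_fun setT g ->
    (forall x, 0 <= g x <= L) ->
  exists (h : T -> R) (N : set B), [/\ continuous h, measurable N,
    (mu N < d%:E)%E & forall x, ~ N x -> `|g x - h x| <= L / 2 ^+ n].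
Proof.
elim: n g L d => [|n IH] g L d L0 d0 mg gL.
  exists (cst 0), set0; split => //.
  - by move=> x; exact: cvg_cst.
  - by rewrite measure0 lte_fin.
  - move=> x _; rewrite /cst subr0 expr0 divr1.
    by have /andP[g0 g1] := gL x; rewrite ger0_norm.
have d2 : 0 < d / 2 by rewrite divr_gt0.
have L2 : 0 < L / 2 by rewrite divr_gt0.
pose A : set B := g @^-1` `[L / 2, +oo[.
have mA : measurable A by rewrite -[A]setTI; apply: mg => //; exact: measurable_itv.
have [F [G [cF oG FA AG h1]]] := borel_regular mu mA d2.
have [u [cu u01 u1 u0]] := urysohn_bump hK hT cF oG (subset_trans FA AG).
have mGF : measurable (G `\` F : set B).
  by apply: measurableD; [exact: open_borel|exact: closed_borel].
(* Subtracting [L / 2] on [A] leaves a function with values in [[0, L / 2]]. The bump [u] equals the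
   indicator of [A] off [G] minus [F], so the other half of [d] is spent there. *)
have [|x|h [N [ch mN Nd hN]]] := IH (fun x => g x - L / 2 * \1_A x)
  (L / 2) (d / 2) L2 d2.
- apply: measurable_funB => //; apply: measurable_funM => //.
- have /andP[g0 g1] := gL x; rewrite indicE.
  have [|] := boolP (x \in A).
    by rewrite inE /A/= in_itv/= andbT mulr1 => ?; apply/andP; split; lra.
  rewrite notin_setE /A/= in_itv/= andbT mulr0 => /negP.
  by rewrite -ltNge => ?; apply/andP; split; lra.
exists (fun x => h x + L / 2 * u x), (N `|` (G `\` F)); split.
- move=> x; apply: cvgD; first exact: ch.
  by apply: cvgM; [exact: cvg_cst|exact: cu].
- exact: measurableU.
- apply: le_lt_trans (measureU2 _ _ _) _ => //.
  by rewrite [d]splitr EFinD lteD.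
- move=> x /not_orP[Nx GFx].
  have ux : u x = \1_A x.
    rewrite indicE; have [|] := boolP (x \in A).
      rewrite inE => /AG Gx; apply: u1; apply: contrapT => Fx.
      by apply: GFx.
    rewrite notin_setE => Ax; apply: u0 => Gx; apply: GFx; split => //.
    by move/FA.
  rewrite ux (_ : _ - _ = g x - L / 2 * \1_A x - h x); last by ring.
  by rewrite exprS invfM mulrA; exact: hN.
Qed.

(** The dyadic approximation is applied to [g + C], with values in [[0, 2C]]. Clamping the result
    restores the bound [C] at no cost, as [clamp] is 1-Lipschitz and fixes the values of [g]. *)
Lemma continuous_approx (mu : {finite_measure set B -> \bar R})
    (g : B -> R) (C e : R) : 0 < C -> 0 < e -> measurable_fun setT g ->
    (forall x, `|g x| <= C) ->
  exists (h : T -> R) (N : set B), [/\ continuous h, forall x, `|h x| <= C,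
    measurable N, (mu N < e%:E)%E & forall x, ~ N x -> `|g x - h x| <= e].
Proof.
move=> C0 e0 mg gC.
have C20 : 0 < C + C by lra.
have [n ne] : exists n, (C + C) / 2 ^+ n <= e.
  have h : 0 < e / (C + C) by rewrite divr_gt0.
  have [n _ /(_ n (leqnn n))/=] := near_infty_natSinv_expn_lt (PosNum h).
  by rewrite ltr_pdivlMr// => hn; exists n; rewrite mulrC -div1r ltW.
have [|x|h [N [ch mN Ne hN]]] :=
    @dyadic_approx mu n (fun x => g x + C) (C + C) e C20 e0.
- exact: measurable_funD.
- by have := gC x; rewrite ler_norml => /andP[? ?]; apply/andP; split; lra.
exists (fun x => clamp C (h x - C)), N; split => //.
- move=> x; apply: (@continuous_comp _ _ _ (fun x => h x - C) (clamp C)).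
    by apply: cvgB; [exact: ch|exact: cvg_cst].
  exact: continuous_clamp.
- by move=> x; apply: clamp_le; exact: ltW.
- move=> x /hN hx; rewrite -[g x](@clamp_id C)//.
  apply: le_trans (clamp_lip _ _ (ltW C0)) _; apply: le_trans ne.
  by rewrite (_ : _ - _ = g x + C - h x)//; ring.
Qed.

End approximation.

(** * Consequences of having strong limit values *)

Section strong_limits.
Set Implicit Arguments.
Unset Strict Implicit.
Unset Printing Implicit Defensive.
Context {R : realType} {T : pseudoPMetricType R}.
Local Notation B := (g_sigma_algebraType (@open T)).

Lemma negligible_outer (mu : {finite_measure set B -> \bar R}) (A : set B) :
  (forall d : R, 0 < d -> exists G : set T,
     [/\ open G, A `<=` G & (mu G <= d%:E)%E]) ->
  mu.-negligible A.
Proof.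
move=> AG.
have /choice[G hG] : forall n : nat, exists G : set T,
    [/\ open G, A `<=` G & (mu G <= n.+1%:R^-1%:E)%E].
  by move=> n; apply: AG; rewrite invr_gt0.
have mG n : measurable (G n : set B) by have [oG _ _] := hG n; exact: open_borel.
have mI : measurable (\bigcap_n (G n : set B)) by exact: bigcapT_measurable.
exists (\bigcap_n (G n : set B)); split => //; last first.
  by move=> x Ax n _; have [_ AGn _] := hG n; exact: AGn.
apply/eqP; rewrite eq_le measure_ge0 andbT; apply/lee_addgt0Pr => e e0.
rewrite add0e; have [n _ /(_ n (leqnn n))/= ne] := near_infty_natSinv_lt (PosNum e0).
have [_ _ Gn] := hG n; apply: (@le_trans _ _ (mu (G n))).
  by apply: le_measure; rewrite ?inE//; exact: bigcap_inf.
by apply: le_trans Gn _; rewrite lee_fin ltW.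
Qed.

Hypothesis hK : compact [set: T].
Hypothesis hT : hausdorff_space T.
Variables (mu : nat -> {finite_measure set B -> \bar R}).
Variable mu0 : {finite_measure set B -> \bar R}.
Hypothesis hmu : weak_star_cvg mu mu0.
Variables (m : nat) (q : nat -> B -> R) (q0 : B -> R) (C : R).
Hypothesis C0 : 0 < C.
Hypothesis mq : forall j, (m < j)%N -> measurable_fun (msupp (mu j)) (q j).
Hypothesis qC : forall j x, (m < j)%N -> msupp (mu j) x -> `|q j x| <= C.
Hypothesis hq : strong_limit_values mu mu0 q q0.

(** Bridges the strong limit condition, which only sees points of the supports, and the portmanteau
    inequality for whole open sets. *)
Let measure_suppI (j : nat) (G : set T) : open G ->
  mu j G = mu j (msupp (mu j) `&` G).
Proof.
move=> oG; have mG : measurable (G : set B) by exact: open_borel.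
have mS := msupp_measurable (mu j).
rewrite (measureDI (mu j) mG mS) setIC [X in (X + _)%E](_ : _ = 0%E) ?add0e//.
apply: (@subset_measure0 _ _ _ (mu j) _ (~` msupp (mu j))) => //.
- exact: measurableD.
- exact: measurableC.
- exact: msupp_full.
Qed.

(** When the slab lies beyond the bound [C], one of the two exceptional sets is the entire support
    of [mu j] for [j > m]. The condition then says that [mu j] of the open set is small, and this
    passes to [mu0]. *)
Lemma strong_limit_level_negligible (a b : R) : a < b -> C < a \/ b < - C ->
  mu0.-negligible [set x | msupp mu0 x /\ a <= q0 x < b].
Proof.
move=> ab aC; apply: negligible_outer => d d0; have [_ hq2] := hq.
(* [e] is half the gap between the slab and [[-C, C]]. *)
have [e [e0 e']] : exists e, 0 < e /\ (C < a - e \/ b + e < - C).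
  case: aC => ?; [exists ((a - C) / 2)|exists ((- C - b) / 2)]; split.
  - lra.
  - left; lra.
  - lra.
  - right; lra.
have [j0 [G [oG [sG hG]]]] := hq2 a b ab e d e0 d0.
exists G; split => //; apply: (weak_star_open hK hT hmu oG).
exists (maxn j0 m.+1) => // j /=; rewrite geq_max => /andP[j0j mj].
have := hG j j0j; rewrite measure_suppI// => /ltW; apply: le_trans.
have qx x : msupp (mu j) x -> - C <= q j x <= C.
  by move=> Kx; rewrite -ler_norml qC.
case: e' => e'.
- rewrite (_ : [set x | _ /\ q j x < a - e] = msupp (mu j)) ?leeDl//.
  apply/seteqP; split=> [x []//|x Kx]; split => //.
  by have /andP[_ ?] := qx x Kx; exact: le_lt_trans e'.
- rewrite (_ : [set x | _ /\ q j x > b + e] = msupp (mu j)) ?leeDr//.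
  apply/seteqP; split=> [x []//|x Kx]; split => //.
  by have /andP[? _] := qx x Kx; exact: lt_le_trans e' _.
Qed.

(** The Borel version of [q0] is extended by zero and clamped. This changes it only where the
    absolute value exceeds [C], a countable union of negligible slabs. *)
Lemma strong_limit_bounded : exists g : B -> R,
  [/\ measurable_fun setT g, forall x, `|g x| <= C &
    mu0.-negligible [set x | msupp mu0 x /\ q0 x <> g x]].
Proof.
have mS := msupp_measurable mu0.
have [[g1 [mg1 [N1 [mN1 N10 N1s]]]] _] := hq.
exists (clamp C \o (g1 \_ (msupp mu0))); split.
- apply: measurableT_comp.
    apply: continuous_measurable_fun; exact: continuous_clamp.
  by apply/(measurable_restrictT _ _).1.
- by move=> x; apply: clamp_le; exact: ltW.
(* These slabs and their mirror images exhaust the points with [|q0 x| > C]. With [n.+2] in the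
   upper end the slab is nondegenerate already for [n = 0]. *)
pose A n : set B :=
  [set x | msupp mu0 x /\ C + n.+1%:R^-1 <= q0 x < C + n.+2%:R].
pose A' n : set B :=
  [set x | msupp mu0 x /\ - (C + n.+2%:R) <= q0 x < - (C + n.+1%:R^-1)].
have lra_key (t u v w : R) : w < t - C -> t < u -> u <= v -> C + w < t < C + v.
  by have := C0 => *; apply/andP; split; lra.
have n0 n : 0 < n.+1%:R^-1 :> R by rewrite invr_gt0.
have n12 n : n.+1%:R^-1 < n.+2%:R :> R.
  apply: (@le_lt_trans _ _ 1); first by rewrite invf_le1// ler1n.
  by rewrite ltr1n.
apply: (@negligibleS _ _ _ _ (N1 `|` (\bigcup_n A n `|` \bigcup_n A' n))).
  move=> x [Kx qg]; have [|N1x] := pselect (N1 x); first by left.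
  right; have qg1 : q0 x = g1 x.
    by apply: contrapT => h; apply: N1x; apply: N1s => /(_ Kx).
  have qC' : C < `|q0 x|.
    rewrite ltNge; apply/negP => qC'; apply: qg.
    by rewrite /= patchE mem_set// -qg1 clamp_id.
  have e0 : 0 < `|q0 x| - C by rewrite subr_gt0.
  have [n1 _ h1] := near_infty_natSinv_lt (PosNum e0).
  pose n := maxn n1 (Num.truncn `|q0 x|).
  have {}h1 : n.+1%:R^-1 < `|q0 x| - C by exact: (h1 n (leq_maxl _ _)).
  have h2 : `|q0 x| < n.+1%:R.
    by rewrite -truncn_le_nat leq_maxr.
  have h3 : n.+1%:R <= n.+2%:R :> R by rewrite ler_nat.
  have /andP[k1 k2] := lra_key _ _ _ _ h1 h2 h3.
  have [q0x|q0x] := ger0P (q0 x); [left|right]; exists n => //; split => //.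
    by move: k1 k2; rewrite ger0_norm// => /ltW -> ->.
  by move: k1 k2; rewrite ltr0_norm// ltrNr ltrNl => -> /ltW ->.
apply: negligibleU; first by exists N1; split.
apply: negligibleU; apply: negligible_bigcup => n;
  apply: strong_limit_level_negligible.
- by rewrite ltrD2l.
- by left; rewrite ltrDl.
- by rewrite ltrN2 ltrD2l.
- by right; rewrite ltrN2 ltrDl.
Qed.

(** Convergence in measure, expressed through the continuous [h] because [q0] and [q j] live on
    different supports. On each slab of width [e], both [q j] and [h] are close to the same
    constant. *)
Lemma strong_limit_in_measure (g : B -> R) (h : T -> R) (N : set B) (e c : R) :
  (forall x, `|g x| <= C) ->
  mu0.-negligible [set x | msupp mu0 x /\ q0 x <> g x] ->
  continuous h -> 0 < e -> measurable N -> (mu0 N < c%:E)%E ->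
  (forall x, ~ N x -> `|g x - h x| <= e) ->
  \forall j \near \oo, (mu j [set x | msupp (mu j) x /\
    (4 * e < `|q j x - h x|)%R] < c%:E)%E.
Proof.
move=> gC [N1 [mN1 N10 qgN1]] ch e0 mN Nc gh.
have fN : mu0 N \is a fin_num by rewrite fin_num_measure.
(* [c'] pays for the closed set [F] left uncovered below; the remainder [c - c'] is divided among
   the [n] exceptional sets, [d] for each. *)
have [c' [Nc' c'c]] : exists c' : R, (mu0 N < c'%:E)%E /\ c' < c.
  move: Nc; rewrite -(fineK fN) lte_fin => Nc.
  by exists ((fine (mu0 N) + c) / 2); split; [rewrite lte_fin|]; lra.
pose n := (Num.truncn ((C + C) / e)).+1.
have hn : C + C < n%:R * e by rewrite -ltr_pdivrMr// truncnS_gt.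
pose a i : R := - C + i%:R * e.
have [_ hq2] := hq.
pose d := (c - c') / n%:R.
have d0 : 0 < d by rewrite divr_gt0 ?subr_gt0// ltr0n.
pose E (G : nat -> set T) j i : set B :=
  ([set x | msupp (mu j) x /\ (q j x < a i - e)%R] `&` G i) `|`
  ([set x | msupp (mu j) x /\ (q j x > a i.+1 + e)%R] `&` G i).
have mlt j (b : R) : (m < j)%N ->
    measurable ([set x | msupp (mu j) x /\ (q j x < b)%R] : set B).
  move=> mj; have := mq mj (msupp_measurable _) (measurable_itv `]-oo, b[).
  congr measurable; apply/seteqP; split => x /=; rewrite in_itv/=; tauto.
have mgt j (b : R) : (m < j)%N ->
    measurable ([set x | msupp (mu j) x /\ (q j x > b)%R] : set B).
  move=> mj; have := mq mj (msupp_measurable _) (measurable_itv `]b, +oo[).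
  congr measurable; apply/seteqP; split => x /=; rewrite in_itv/= andbT; tauto.
have aS i : a i.+1 = a i + e by rewrite /a -natr1 mulrDl mul1r addrA.
have /choice[jG hG] : forall i, exists jG : nat * set T, [/\ open jG.2,
    [set x | msupp mu0 x /\ a i <= q0 x < a i.+1] `<=` jG.2 &
    forall j, (jG.1 <= j)%N ->
    (mu j ([set x | msupp (mu j) x /\ (q j x < a i - e)%R] `&` jG.2) +
     mu j ([set x | msupp (mu j) x /\ (q j x > a i.+1 + e)%R] `&` jG.2)
       < d%:E)%E].
  move=> i; have [|j0 [G [oG [sG h1]]]] := hq2 (a i) (a i.+1) _ e d e0 d0.
    by rewrite aS ltrDl.
  by exists (j0, G).
pose G i := (jG i).2.
have oG i : open (G i) by have [] := hG i.
(* On [H i] and outside [E G j i], [q j] lies in [[a i - e, a i + 2e]] and [h] in the open interval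
   of radius [2e] about [a i], whence the constant 4. *)
pose H i := G i `&` h @^-1` `]a i - 2 * e, a i + 2 * e[.
pose F : set T := ~` \bigcup_(i in `I_n) H i.
have cF : closed F.
  apply: open_closedC; apply: bigcup_open => i _; apply: openI => //.
  by move/continuousP : ch; apply; exact: interval_open.
have mF : measurable (F : set B) by exact: closed_borel.
have F0 : (mu0 F < c'%:E)%E.
  apply: le_lt_trans Nc'.
  have mS : measurable (~` msupp mu0).
    by apply: measurableC; exact: msupp_measurable.
  (* Elsewhere [q0 = g] falls into some slab [i < n], and [h] is within [e] of it, so the point
     belongs to [H i]. *)
  have : (mu0 F <= mu0 (N `|` (N1 `|` ~` msupp mu0)))%E.
    apply: le_measure; rewrite ?inE//.
      by apply: measurableU => //; exact: measurableU.
    move=> x Fx; have [Kx|Kx] := pselect (msupp mu0 x); last by right; right.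
    have [|N1x] := pselect (N1 x); first by right; left.
    have [|Nx] := pselect (N x); first by left.
    exfalso; apply: Fx.
    have qg : q0 x = g x by apply: contrapT => qg; apply: N1x; exact: qgN1.
    have qC0 : 0 <= (q0 x + C) / e.
      rewrite divr_ge0 ?(ltW e0)// qg.
      by have := gC x; rewrite ler_norml => /andP[? _]; lra.
    pose i := Num.truncn ((q0 x + C) / e).
    have /andP[i1 i2] := truncn_itv qC0.
    move: i1 i2; rewrite -/i ler_pdivlMr// ltr_pdivrMr// => i1 i2.
    have ai : a i <= q0 x < a i.+1 by rewrite /a; apply/andP; split; lra.
    have /andP[ai1 ai2] := ai.
    exists i => /=.
      rewrite -(ltr_nat R) -(ltr_pM2r e0); apply: le_lt_trans i1 _.
      apply: le_lt_trans hn; rewrite lerD2r qg.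
      by have := gC x; rewrite ler_norml => /andP[].
    split; first by have [_ sG _] := hG i; apply: sG.
    rewrite /= in_itv/=; have := gh x Nx; rewrite -qg ler_distlC aS in ai2 *.
    by move=> /andP[? ?]; apply/andP; split; lra.
  have NS0 : mu0 (N1 `|` ~` msupp mu0) = 0%E.
    by rewrite (measureU0 mN1 mS)//; exact: msupp_full.
  by rewrite (measureU0 mN (measurableU _ _ mN1 mS) NS0).
have EFj := weak_star_closed hK hT hmu cF F0.
(* Only finitely many slabs occur, so one threshold serves them all. *)
pose J := \max_(i < n) (jG i).1.
near=> j.
have mj : (m < j)%N by near: j; exact: nbhs_infty_gt.
have Jj : (J <= j)%N by near: j; exact: nbhs_infty_ge.
have Fj : (mu j F < c'%:E)%E by near: j.
have mE i : measurable (E G j i).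
  have mGi : measurable (G i : set B) by exact: open_borel.
  by apply: measurableU; apply: measurableI => //; [exact: mlt|exact: mgt].
have Ed i : (i < n)%N -> (mu j (E G j i) <= d%:E)%E.
  move=> ni; have [_ _ /(_ j)] := hG i; move=> /(_ _)/ltW Ej.
  apply: le_trans (Ej _); last first.
    by apply: leq_trans Jj; exact: (leq_bigmax (Ordinal ni)).
  have mGi : measurable (G i : set B) by exact: open_borel.
  by apply: measureU2; apply: measurableI => //; [exact: mlt|exact: mgt].
have EU k : (k <= n)%N ->
    (mu j (\big[setU/set0]_(i < k) E G j i) <= (k%:R * d)%:E)%E.
  elim: k => [|k IH] kn; first by rewrite big_ord0 measure0 mul0r.
  rewrite big_ord_recr/= -natr1 mulrDl mul1r EFinD.
  apply: le_trans (measureU2 _ _ _) _ => //.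
    by apply: bigsetU_measurable.
  by apply: leeD; [apply: IH; exact: ltnW|exact: Ed].
have mEU : measurable (\big[setU/set0]_(i < n) E G j i).
  by apply: bigsetU_measurable.
apply: (@le_lt_trans _ _ (mu j (F `|` \big[setU/set0]_(i < n) E G j i))).
  apply: le_measure; rewrite ?inE//.
  - have mqh : measurable_fun (msupp (mu j)) (fun x => `|q j x - h x| : R).
      apply: measurableT_comp => //; apply: measurable_funB; first exact: mq.
      by apply: measurable_funTS; exact: continuous_borel.
    have := mqh (msupp_measurable _) _ (measurable_itv `]4 * e, +oo[).
    congr measurable; apply/seteqP; split => x /=; rewrite in_itv/= andbT; tauto.
  - exact: measurableU.
  move=> x [Kx qh]; have [|/contrapT[i /= ni [Gx hx]]] := pselect (F x).
    by left.
  right; rewrite -(bigcup_mkord n (E G j)); exists i => //.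
  have [qa|qa] := ltP (q j x) (a i - e); first by left.
  have [qb|qb] := ltP (a i.+1 + e) (q j x); first by right.
  exfalso; move: hx qb qh; rewrite /= in_itv/= aS => /andP[? ?] ?.
  rewrite ltNge => /negP; apply; rewrite ler_distlC.
  by apply/andP; split; lra.
apply: le_lt_trans (measureU2 _ _ _) _ => //.
rewrite (_ : c = c' + (c - c')); last by rewrite addrC subrK.
rewrite EFinD; apply: lte_leD => //; first by rewrite fin_num_measure.
have := EU _ (leqnn n); rewrite (_ : n%:R * d = c - c')//.
by rewrite /d mulrC divfK// pnatr_eq0.
Unshelve. all: by end_near. Qed.

End strong_limits.

(** * Integral estimates: null sets, perturbation and uniform integrability *)

Section integrals.
Set Implicit Arguments.
Unset Strict Implicit.
Unset Printing Implicit Defensive.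
Import HBNNSimple.
Context d (X : measurableType d) {R : realType}.
Variable mu : {measure set X -> \bar R}.
Local Open Scope ereal_scope.

(** A simple function below [f], set to zero on [N], lies below [g] and keeps its integral. *)
Lemma ge0_le_integral_negligible (f g : X -> \bar R) (N : set X) :
  measurable N -> mu N = 0 -> (forall x, 0 <= f x) -> (forall x, 0 <= g x) ->
  (forall x, ~ N x -> f x = g x) -> \int[mu]_x f x <= \int[mu]_x g x.
Proof.
move=> mN N0 f0 g0 fg; rewrite !ge0_integralTE//.
apply: ge_ereal_sup => _ [h /= hf <-].
have mNC : measurable (~` N) by exact: measurableC.
apply: ereal_sup_ubound; exists (proj_nnsfun h mNC).
  move=> x /=; rewrite mindicE; have [|] := boolP (x \in ~` N).
    by rewrite inE mulr1 => /fg <-.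
  by rewrite mulr0.
rewrite -!integralT_nnsfun; apply: ae_eq_integral => //.
- by apply/measurable_EFinP; exact: measurable_funPT.
- by apply/measurable_EFinP; exact: measurable_funPT.
exists N; split => // x /= hx; apply: contrapT => Nx; apply: hx => _.
by rewrite mindicE mem_set// mulr1.
Qed.

(* f and g need not be measurable: the integral of an arbitrary function is a
   supremum over simple functions, which may be set to zero on a null set. *)
Lemma negligible_eq_integral (D : set X) (f g : X -> \bar R) :
  mu.-negligible [set x | D x /\ f x <> g x] ->
  \int[mu]_(x in D) f x = \int[mu]_(x in D) g x.
Proof.
move=> [N [mN N0 fgN]].
have fgD x : ~ N x -> (f \_ D) x = (g \_ D) x.
  move=> Nx; rewrite !patchE; case: ifPn => // /set_mem Dx.
  by apply: contrapT => fg; apply: Nx; exact: fgN.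
rewrite integral_mkcond [RHS]integral_mkcond integralE [RHS]integralE.
congr (_ - _); apply/eqP; rewrite eq_le; apply/andP; split;
  apply: (ge0_le_integral_negligible mN N0) => // x /fgD;
  by rewrite ?funeposE ?funenegE => ->.
Qed.

(** Write [q f = h f + (q - h) f] and bound [|q - h|] by [e] off [S] and by [C + C] on [S]. *)
Lemma integral_perturb (D S : set X) (q h f : X -> R) (C e : R) :
  measurable D -> measurable S -> S `<=` D ->
  measurable_fun D q -> measurable_fun D h -> (0 <= C)%R -> (0 <= e)%R ->
  (forall x, D x -> `|q x| <= C)%R -> (forall x, D x -> `|h x| <= C)%R ->
  mu.-integrable D (EFin \o f) ->
  (forall x, D x -> ~ S x -> `|q x - h x| <= e)%R ->
  \int[mu]_(x in D) (q x * f x)%:E <= \int[mu]_(x in D) (h x * f x)%:E +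
    (e%:E * \int[mu]_(x in D) `|f x|%:E +
     (C + C)%:E * \int[mu]_(x in S) `|f x|%:E).
Proof.
move=> mD mS SD mq mh C0 e0 qC hC intf qh.
have mf : measurable_fun D f by apply/measurable_EFinP; case/integrableP: intf.
have intbf (k : X -> R) : measurable_fun D k -> (forall x, D x -> `|k x| <= C)%R ->
    mu.-integrable D (fun x => (k x * f x)%:E).
  move=> mk kC; apply: (@le_integrable _ _ _ _ _ mD _ (fun x => C%:E * (f x)%:E)).
  - by apply/measurable_EFinP; exact: measurable_funM.
  - move=> x Dx /=; rewrite lee_fin !normrM ler_wpM2r//.
    by rewrite (ger0_norm C0) kC.
  - exact: (integrableZl mD C intf).
have intfn : mu.-integrable D (fun x => `|f x|%:E).
  by have := integrable_abse intf.
have intS : mu.-integrable D (fun x => (`|f x| * \1_S x)%:E).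
  apply: (@le_integrable _ _ _ _ _ mD _ (fun x => `|f x|%:E)) => //.
    apply/measurable_EFinP; apply: measurable_funM => //.
    exact: measurableT_comp.
  move=> x Dx /=; rewrite lee_fin normrM normr_id.
  by rewrite ler_piMr// indicE; case: (_ \in _); rewrite ?normr1 ?normr0.
have -> : \int[mu]_(x in S) `|f x|%:E = \int[mu]_(x in D) (`|f x| * \1_S x)%:E.
  rewrite -[in LHS](setIidr SD) integral_mkcondr; apply: eq_integral => x _.
  by rewrite patchE indicE; case: ifPn => _; rewrite ?mulr1 ?mulr0.
rewrite -!integralZl// -!integralD//; last 4 first.
- exact: intbf.
- by apply: integrableD => //; exact: integrableZl.
- exact: integrableZl.
- exact: integrableZl.
apply: le_integral => //.
- exact: intbf.
- apply: integrableD => //; first exact: intbf.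
  by apply: integrableD => //; exact: integrableZl.
move=> x /set_mem Dx; rewrite -!EFinM -!EFinD lee_fin.
have -> : (q x * f x = h x * f x + (q x - h x) * f x)%R by ring.
rewrite lerD2l; apply: le_trans (ler_norm _) _; rewrite normrM.
rewrite indicE; have [|] := boolP (x \in S); last first.
  rewrite notin_setE mulr0 mulr0 addr0 => Sx.
  by rewrite ler_wpM2r// qh.
move=> _; rewrite mulr1 -mulrDl ler_wpM2r//.
apply: le_trans (ler_normB _ _) _.
by apply: le_trans (lerD (qC _ Dx) (hC _ Dx)) _; rewrite lerDr.
Qed.

(** If [t > l], then [t^p = t^(p-1) t] is at least [l^(p-1) t], so the second term alone
    dominates. *)
Lemma le_powR_truncation (p l t : R) : (1 < p)%R -> (0 < l)%R -> (0 <= t)%R ->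
  (t <= l + (l `^ (p - 1))^-1 * t `^ p)%R.
Proof.
move=> p1 l0 t0; have l1 : (0 < l `^ (p - 1))%R by exact: powR_gt0.
have [tl|lt] := lerP t l.
  by apply: le_trans tl _; rewrite lerDl mulr_ge0// ?invr_ge0 ?powR_ge0.
apply: (@le_trans _ _ ((l `^ (p - 1))^-1 * t `^ p))%R; last by rewrite lerDr ltW.
have t1 : (0 < t)%R by exact: lt_trans lt.
have tp : (t `^ p = t `^ (p - 1) * t)%R.
  rewrite -[in LHS](subrK 1%R p) [LHS]powRD; last first.
    by apply/implyP => _; exact: lt0r_neq0.
  by rewrite powRr1.
rewrite mulrC ler_pdivlMr// tp mulrC ler_wpM2r//.
by apply: ge0_ler_powR; rewrite ?nnegrE ?subr_ge0 ?ltW.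
Qed.

(** Quantitative uniform integrability: the bound depends on [f] only through [L]. A large [l] makes
    the last term small, then a small [mu S] the first. *)
Lemma integral_truncation (D S : set X) (f : X -> R) (p l L : R) :
  (1 < p)%R -> (0 < l)%R -> measurable D -> measurable S -> S `<=` D ->
  measurable_fun D f -> \int[mu]_(x in D) (`|f x| `^ p)%:E <= L%:E ->
  \int[mu]_(x in S) `|f x|%:E <= l%:E * mu S + ((l `^ (p - 1))^-1 * L)%:E.
Proof.
move=> p1 l0 mD mS SD mf fL.
have mfS : measurable_fun S f by exact: measurable_funS mf.
have mfn : measurable_fun S (fun x => `|f x|%R) by exact: measurableT_comp.
have mfpD : measurable_fun D (fun x => (`|f x| `^ p)%R).
  apply: (measurableT_comp (measurable_powR p)); exact: measurableT_comp.
have mfp : measurable_fun S (fun x => (`|f x| `^ p)%R).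
  exact: measurable_funS mfpD.
have c0 : (0 <= (l `^ (p - 1))^-1)%R by rewrite invr_ge0 powR_ge0.
apply: (@le_trans _ _ (\int[mu]_(x in S)
    (l%:E + ((l `^ (p - 1))^-1)%:E * (`|f x| `^ p)%:E))).
  apply: ge0_le_integral => //.
  - exact/measurable_EFinP.
  - apply/measurable_EFinP; apply: measurable_funD => //.
    exact: measurable_funM.
  - by move=> x Sx; rewrite -EFinM -EFinD lee_fin le_powR_truncation.
rewrite ge0_integralD//; last 3 first.
- by move=> x _; rewrite lee_fin ltW.
- by move=> x _; rewrite -EFinM lee_fin mulr_ge0// powR_ge0.
- by apply/measurable_EFinP; exact: measurable_funM.
rewrite integral_cst// leeD2l// ge0_integralZl_EFin//; last first.
  exact/measurable_EFinP.
rewrite EFinM lee_wpmul2l//; apply: le_trans fL.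
apply: ge0_subset_integral => //; exact/measurable_EFinP.
Qed.

End integrals.

(** * Passage to the limit in the integral of a strongly times a weakly convergent sequence *)

Section main.
Set Implicit Arguments.
Unset Strict Implicit.
Unset Printing Implicit Defensive.
Context {R : realType} {T : pseudoPMetricType R}.
Local Notation B := (g_sigma_algebraType (@open T)).

(** The upper limit is an infimum of suprema over eventual sets of indices; being less than
    infinity, it leaves one such set with finite supremum. *)
Lemma LpM_norm_bound (mu : nat -> {measure set B -> \bar R}) (p : R)
    (phi : nat -> B -> R) : 0 < p -> (LpM_norm mu p phi < +oo)%E ->
  exists2 L : R, 0 < L & \forall j \near \oo,
    (\int[mu j]_(x in msupp (mu j)) (`|phi j x| `^ p)%:E <= L%:E)%E.
Proof.
move=> p0 /ereal_inf_lt[_ [A Aoo <-]] supA.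
have [M M0 AM] : exists2 M : R, 0 <= M &
    forall j, A j -> (Lp_norm (mu j) p (phi j) <= M%:E)%E.
  pose u j := Lp_norm (mu j) p (phi j).
  exists (Num.max 0 (fine (ereal_sup (u @` A)))); first by rewrite le_max lexx.
  move=> j Aj; have uj : (u j <= ereal_sup (u @` A))%E.
    by apply: ereal_sup_ubound; exists j.
  have u0 : (0 <= u j)%E by exact: poweR_ge0.
  have sfin : ereal_sup (u @` A) \is a fin_num.
    by rewrite fin_numElt supA (lt_le_trans _ (le_trans u0 uj)).
  by apply: le_trans uj _; rewrite -(fineK sfin) lee_fin le_max lexx orbT.
exists (M `^ p + 1); first by rewrite ltr_wpDl// powR_ge0.
apply: filterS Aoo => j /AM.
set I := (\int[_]_(_ in _) _)%E.
have I0 : (0 <= I)%E.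
  by apply: integral_ge0 => x _; rewrite lee_fin powR_ge0.
rewrite /Lp_norm -/I => IM.
have -> : I = ((I `^ p^-1) `^ p)%E.
  by rewrite -poweRrM mulVf ?poweRe1//; exact: lt0r_neq0.
apply: (@le_trans _ _ ((M%:E) `^ p)%E).
  apply: gt0_ler_poweR => //; first exact: ltW.
    by rewrite in_itv/= poweR_ge0 leey.
  by rewrite in_itv/= lee_fin M0 leey.
by rewrite poweR_EFin lee_fin lerDl.
Qed.

Lemma exists_powR_threshold (p a e : R) : 1 < p -> 0 < a -> 0 < e ->
  exists2 l : R, 0 < l & (l `^ (p - 1))^-1 * a <= e.
Proof.
move=> p1 a0 e0; have ae : 0 < a / e by rewrite divr_gt0.
exists ((a / e) `^ (p - 1)^-1); first exact: powR_gt0.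
rewrite -powRrM mulVf ?gt_eqF ?subr_gt0// (powRr1 (ltW ae)).
by rewrite invf_div divfK//; exact: lt0r_neq0.
Qed.

Lemma measurable_kernel_section (D1 D2 : set B) (P : T -> T -> R) (z : T) :
  measurable D1 -> measurable D2 -> D1 z ->
  measurable_fun [set w : B * B | D1 w.1 /\ D2 w.2] (fun w => P w.1 w.2) ->
  measurable_fun D2 (P z : B -> R).
Proof.
move=> mD1 mD2 D1z mP _ Y mY.
have mD : measurable [set w : B * B | D1 w.1 /\ D2 w.2].
  by have := measurableX mD1 mD2; congr measurable.
have := @measurable_xsection _ _ B B _ z (mP mD Y mY).
congr measurable; apply/seteqP; split => x.
  by rewrite /xsection/= inE => -[[]].
by move=> [D2x Px]; rewrite /xsection/= inE.
Qed.

Hypothesis hK : compact [set: T].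
Hypothesis hT : hausdorff_space T.
Variables (mu : nat -> {finite_measure set B -> \bar R}).
Variable mu0 : {finite_measure set B -> \bar R}.
Hypothesis hmu : weak_star_cvg mu mu0.
Variables (p : R) (phi : nat -> B -> R) (phistar : B -> R).
Hypothesis p1 : 1 < p.
Hypothesis hphi : in_Ap mu mu0 p phi phistar.
Variables (m : nat) (q : nat -> B -> R) (q0 : B -> R) (C : R).
Hypothesis C0 : 0 < C.
Hypothesis mq : forall j, (m < j)%N -> measurable_fun (msupp (mu j)) (q j).
Hypothesis qC : forall j x, (m < j)%N -> msupp (mu j) x -> `|q j x| <= C.
Hypothesis hq : strong_limit_values mu mu0 q q0.

(** The statement for one fixed point [z]: [q j] stands for [P j z], [q0] for [P0 z] and [t] for
    [phi m z]. *)
Lemma le_integral_strong_weak_limit (t : R) :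
  (forall j, (m < j)%N ->
    (t%:E <= \int[mu j]_(x in msupp (mu j)) (q j x * phi j x)%:E)%E) ->
  (t%:E <= \int[mu0]_(x in msupp mu0) (q0 x * phistar x)%:E)%E.
Proof.
move=> tq.
have mS0 := msupp_measurable mu0.
have mS j := msupp_measurable (mu j).
have [mphi [[[[f [mf [N1 [mN1 N10 N1s]]]] phioo] wphi] phiL]] := hphi.
have [g [mg gC qg]] := strong_limit_bounded hK hT hmu C0 qC hq.
have phif : mu0.-negligible [set x | msupp mu0 x /\ phistar x <> f x].
  by exists N1; split => // x [Kx h]; apply: N1s => /(_ Kx).
have intf : mu0.-integrable (msupp mu0) (EFin \o f).
  apply/integrableP; split; first exact/measurable_EFinP.
  apply: le_lt_trans phioo; rewrite le_eqVlt; apply/orP; left; apply/eqP.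
  apply: negligible_eq_integral; apply: negligibleS phif => x [Kx h].
  by split => // h'; apply: h; rewrite /= h'.
(* [q0] and [phistar] are only almost everywhere equal to Borel functions; from here on [g] and [f]
   replace them. *)
have -> : (\int[mu0]_(x in msupp mu0) (q0 x * phistar x)%:E =
           \int[mu0]_(x in msupp mu0) (g x * f x)%:E)%E.
  apply: negligible_eq_integral; apply: negligibleS (negligibleU qg phif).
  move=> x [Kx h]; have [|qgx] := pselect (q0 x <> g x); first by left.
  right; split => // pf; apply: h; move/contrapT : qgx => ->.
  by rewrite pf.
have {}wphi (h : T -> R) : continuous h ->
    (fun j => (\int[mu j]_(x in msupp (mu j)) (h x * phi j x)%:E)%E) @ \oo -->
    (\int[mu0]_(x in msupp mu0) (h x * f x)%:E)%E.
  move=> ch; rewrite (_ : (\int[mu0]_(x in _) _)%E =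
      (\int[mu0]_(x in msupp mu0) (h x * phistar x)%:E)%E); first exact: wphi.
  apply: negligible_eq_integral; apply: negligibleS phif.
  by move=> x [Kx h']; split => // pf; apply: h'; rewrite pf.
have [L L0 phiL'] := LpM_norm_bound (lt_trans ltr01 p1) phiL.
pose b := fine (mu0 setT) + 1.
have b0 : 0 < b by rewrite ltr_wpDl// fine_ge0.
have mub : \forall j \near \oo, (mu j setT < b%:E)%E.
  apply: (weak_star_closed hK hT hmu closedT).
  by rewrite EFinD fineK ?fin_num_measure// lteDl ?lte_fin ?fin_num_measure.
(* [W] eventually bounds the [L^1] norms of the [phi j], by truncation at level 1. *)
pose W := b + L.
have W0 : 0 < W by rewrite addr_gt0.
pose V := fine (\int[mu0]_(x in msupp mu0) `|f x|%:E)%E.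
have VE : (\int[mu0]_(x in msupp mu0) `|f x|%:E = V%:E)%E.
  rewrite fineK//; exact: integrable_fin_num (integrable_abse intf).
have V0 : 0 <= V by apply: fine_ge0; exact: integral_ge0.
apply/lee_addgt0Pr => eps eps0.
(* Two shares pay for replacing [g] by [h] under [mu0], three for replacing [q j] by [h] under
   [mu j]. *)
pose e := eps / 5.
have e0 : 0 < e by rewrite divr_gt0.
have C2 : 0 < C + C by rewrite addr_gt0.
have eC0 : 0 < e / (C + C) by rewrite divr_gt0.
(* The truncation level is fixed before [s], which has to be small relative to it. *)
have [l l0 lL] := exists_powR_threshold p1 L0 eC0.
(* Absolute continuity of the integral of [|f|], applied to [f] extended by zero. *)
have [d2 d20 hd2] : exists2 d2 : R, 0 < d2 & forall A : set B, measurable A ->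
    A `<=` msupp mu0 -> (mu0 A < d2%:E)%E ->
    (\int[mu0]_(x in A) `|f x|%:E <= (e / (C + C))%:E)%E.
  have intfT : mu0.-integrable setT (EFin \o (f \_ (msupp mu0))).
    by rewrite -restrict_EFin; apply/integrable_restrict => //=; rewrite setTI.
  have [d2 [d20 hd2]] := integral_normr_continuous intfT eC0.
  exists d2 => // A mA AS Ad; have := hd2 A mA Ad.
  have -> : (\int[mu0]_(x in A) `|f x|%:E =
             \int[mu0]_(x in A) `|(f \_ (msupp mu0)) x|%:E)%E.
    apply: eq_integral => x /set_mem Ax.
    by rewrite patchE mem_set//; exact: AS.
  have intA := integrableS measurableT mA (@subsetT _ A) intfT.
  move=> /ltW; rewrite -lee_fin fineK//.
  exact: integrable_fin_num (integrable_abse intA).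
(* The entries control, in order: [|q j - h| <= 4s] against the [L^1] bound [W]; [|g - h| <= s]
   against [V], which may vanish, hence [V + 1]; the truncated part on the bad set of [mu j]; and
   the integral of [|f|] over [N]. *)
pose s := Num.min (e / (4 * W)) (Num.min (e / (V + 1))
  (Num.min (e / ((C + C) * l)) d2)).
have s0 : 0 < s.
  by rewrite !lt_min d20 !divr_gt0 ?mulr_gt0// ltr_wpDl.
have [s1 s2 s3 s4] : [/\ s * (4 * W) <= e, s * (V + 1) <= e,
    (C + C) * (l * s) <= e & s <= d2].
  split; last by rewrite /s !ge_min lexx !orbT.
  - by rewrite -ler_pdivlMr ?mulr_gt0// /s ge_min lexx.
  - by rewrite -ler_pdivlMr ?ltr_wpDl// /s !ge_min lexx orbT.
  - by rewrite mulrA mulrC -ler_pdivlMr ?mulr_gt0// /s !ge_min lexx !orbT.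
have [h [N [ch hC mN Ns gh]]] := continuous_approx hK hT mu0 C0 s0 mg gC.
have qh := strong_limit_in_measure hK hT hmu mq hq gC qg ch s0 mN Ns gh.
have mh : measurable_fun setT (h : B -> R) by exact: continuous_borel.
have hf_le : (\int[mu0]_(x in msupp mu0) (h x * f x)%:E <=
    \int[mu0]_(x in msupp mu0) (g x * f x)%:E + (e + e)%:E)%E.
  have mNS : measurable (N `&` msupp mu0) by exact: measurableI.
  apply: le_trans (integral_perturb mS0 mNS (@subIsetr _ _ _)
    (measurable_funTS mh) (measurable_funTS mg) (ltW C0) (ltW s0)
    (fun x _ => hC x) (fun x _ => gC x) intf _) _.
    by move=> x Kx NKx; rewrite distrC; apply: gh => Nx; exact: NKx.
  apply: leeD2l; rewrite (EFinD e e); apply: leeD.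
    rewrite VE -EFinM lee_fin; apply: le_trans s2.
    by rewrite ler_wpM2l ?(ltW s0)// lerDl.
  apply: (@le_trans _ _ ((C + C)%:E * (e / (C + C))%:E)%E).
    apply: lee_wpmul2l; first by rewrite lee_fin ltW.
    apply: hd2 => //; apply: le_lt_trans (lt_le_trans Ns _).
      by apply: le_measure; rewrite ?inE//.
    by rewrite lee_fin.
  by rewrite -EFinM lee_fin mulrC divfK// gt_eqF.
(* The three errors are [4 s W] off the bad set and, on it, [2C l s] for the truncated part and [2C]
   times the tail term for the rest. *)
have qh_le : \forall j \near \oo, (t%:E <=
    \int[mu j]_(x in msupp (mu j)) (h x * phi j x)%:E + (e + (e + e))%:E)%E.
  near=> j.
  have mj : (m < j)%N by near: j; exact: nbhs_infty_gt.
  have Lj : (\int[mu j]_(x in msupp (mu j)) (`|phi j x| `^ p)%:E <= L%:E)%E.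
    by near: j.
  have bj : (mu j setT < b%:E)%E by near: j.
  have Sj : (mu j [set x | msupp (mu j) x /\ (4 * s < `|q j x - h x|)%R]
      < s%:E)%E by near: j.
  pose S : set B := [set x | msupp (mu j) x /\ (4 * s < `|q j x - h x|)%R].
  have mS' : measurable S.
    have mqh : measurable_fun (msupp (mu j)) (fun x => `|q j x - h x| : R).
      apply: measurableT_comp => //; apply: measurable_funB; first exact: mq.
      exact: measurable_funTS.
    have := mqh (mS j) _ (measurable_itv `]4 * s, +oo[).
    by congr measurable; apply/seteqP; split => x /=; rewrite in_itv/= andbT.
  have SK : S `<=` msupp (mu j) by move=> x [].
  have phi1 : (\int[mu j]_(x in msupp (mu j)) `|phi j x|%:E <= W%:E)%E.
    apply: le_trans (integral_truncation p1 ltr01 (mS j) (mS j)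
      (@subset_refl _ _) (mphi j) Lj) _.
    rewrite powR1 invr1 mul1r mul1e EFinD; apply: leeD2r.
    by apply: le_trans (ltW bj); apply: le_measure; rewrite ?inE.
  have intphi : (mu j).-integrable (msupp (mu j)) (EFin \o phi j).
    apply/integrableP; split; first by apply/measurable_EFinP; exact: mphi.
    by apply: le_lt_trans phi1 _; rewrite ltry.
  have s40 : 0 <= 4 * s by rewrite mulr_ge0// ltW.
  apply: le_trans (tq j mj) _.
  apply: le_trans (integral_perturb (mS j) mS' SK (mq mj)
    (measurable_funTS mh) (ltW C0) s40 (fun x => qC mj) (fun x _ => hC x)
    intphi _) _.
    by move=> x Kx Sx; rewrite leNgt; apply/negP => h4; exact: Sx.
  apply: leeD2l; rewrite (EFinD e (e + e)); apply: leeD.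
    apply: (@le_trans _ _ ((4 * s)%:E * W%:E)%E).
      by apply: lee_wpmul2l => //; rewrite lee_fin mulr_ge0// ltW.
    by rewrite -EFinM lee_fin mulrAC mulrC.
  apply: (@le_trans _ _ ((C + C)%:E * (l * s + e / (C + C))%:E)%E).
    apply: lee_wpmul2l; first by rewrite lee_fin ltW.
    apply: le_trans (integral_truncation p1 l0 (mS j) mS' SK (mphi j) Lj) _.
    rewrite EFinD (EFinM l s); apply: leeD; last by rewrite lee_fin.
    by apply: lee_wpmul2l; [rewrite lee_fin ltW|exact: ltW].
  by rewrite -EFinM lee_fin mulrDr lerD// mulrC divfK// gt_eqF.
have tl : (t%:E <= \int[mu0]_(x in msupp mu0) (h x * f x)%:E + (e + (e + e))%:E)%E.
  have cv : (fun j => (\int[mu j]_(x in msupp (mu j)) (h x * phi j x)%:E +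
      (e + (e + e))%:E)%E) @ \oo -->
      (\int[mu0]_(x in msupp mu0) (h x * f x)%:E + (e + (e + e))%:E)%E.
    apply: cvgeD; [by rewrite fin_num_adde_defl|exact: wphi|exact: cvg_cst].
  rewrite -(cvg_lim _ cv)//; apply: lime_ge qh_le.
  by apply/cvg_ex; eexists; exact: cv.
apply: le_trans tl _; apply: (le_trans (leeD hf_le (lexx _))).
rewrite -addeA; apply: leeD2l; rewrite -EFinD lee_fin /e; lra.
Unshelve. all: by end_near. Qed.

End main.

Theorem theorem4p4 (R : realType) (T : pseudoPMetricType R)
  (hT : hausdorff_space T)
  (hK : compact [set: T])
  (mu : nat -> {finite_measure set (g_sigma_algebraType (@open T)) -> \bar R})
  (mu0 : {finite_measure set (g_sigma_algebraType (@open T)) -> \bar R})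
  (hmu : weak_star_cvg mu mu0)
  (P : nat -> T -> T -> R) (P0 : T -> T -> R)
  (hPmeas : forall j : nat,
     measurable_fun
       [set w : g_sigma_algebraType (@open T) * g_sigma_algebraType (@open T)
          | (exists m : nat, (m < j)%N /\ msupp (mu m) w.1) /\ msupp (mu j) w.2]
       (fun w => P j w.1 w.2))
  (hPbd : forall (m : nat) (z : T), msupp (mu m) z ->
     exists C : R, forall (j : nat) (zeta : T), (m < j)%N ->
       msupp (mu j) zeta -> `|P j z zeta| <= C)
  (hPlim : forall (m : nat) (z : T), msupp (mu m) z ->
     strong_limit_values mu mu0 (fun j => P j z) (P0 z))
  (p : R) (hp : 1 < p)
  (phi : nat -> T -> R) (phistar : T -> R)
  (hphi : in_Ap mu mu0 p phi phistar)
  (hsub : forall (j m : nat) (z : T), (m < j)%N -> msupp (mu m) z ->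
     ((phi m z)%:E <=
        \int[mu j]_(zeta in msupp (mu j)) (P j z zeta * phi j zeta)%:E)%E) :
  forall (m : nat) (z : T), msupp (mu m) z ->
    ((phi m z)%:E <=
       \int[mu0]_(zeta in msupp mu0) (P0 z zeta * phistar zeta)%:E)%E.
Proof.
move=> m z Kz; have [C0 hC0] := hPbd m z Kz.
(* The given bound may fail to be positive, so it is replaced by its maximum with 1. *)
apply: (@le_integral_strong_weak_limit R T hK hT mu mu0 hmu p phi phistar hp
  hphi m (fun j => P j z) (P0 z) (Num.max 1 C0)).
- by rewrite lt_max ltr01.
- move=> j mj.
  (* Sections of jointly measurable functions are measurable once the first factor of the domain is
     Borel, here a countable union of closed supports. *)
  apply: (measurable_kernel_section (D1 := [set x | exists m : nat,
      (m < j)%N /\ msupp (mu m) x])) (hPmeas j).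
  + rewrite (_ : [set x | _] = \bigcup_(i in `I_j) msupp (mu i)).
      by apply: bigcup_measurable => i _; exact: msupp_measurable.
    by apply/seteqP; split => x [i]; [case; exists i|exists i].
  + exact: msupp_measurable.
  + by exists m.
- by move=> j x mj Kx; rewrite le_max hC0 ?orbT.
- exact: (hPlim m z Kz).
- by move=> j mj; exact: (hsub j m z mj Kz).
Qed.
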